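(* Let $p\in(1,2)$. Let $f:\mathbb{R}^d\to\mathbb{R}$ be $(L_0,L_1)$-smooth, and let the stochastic gradient oracle be unbiased and satisfy the strong growth condition under heavy-tailed noise: there is $\rho\ge1$ such that $\mathbb{E}_\xi[\|\nabla f(x,\xi)-\nabla f(x)\|^p]\le(\rho-1)\|\nabla f(x)\|^p$ for all $x\in\mathbb{R}^d$. Then NSGD with any $\lambda>0$, constant step size $0<\eta\le\frac{\lambda}{L_0+L_1\lambda}$ and batch size $B\ge 2^{\frac{3p+1}{p-1}}(\rho-1)^{\frac1{p-1}}$ guarantees, after $N\ge1$ iterations, $$\min_{k\in\{0,\dots,N-1\}}\mathbb{E}\big[\|\nabla f(x^k)\|\big]\le\frac{4F_0}{\eta N}+6\lambda,$$ where $F_0=f(x^0)-f^*$.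
   Context: Setting: $f(x)=\mathbb{E}_{\xi\sim\mathcal D}[f(x,\xi)]$ is differentiable on $\mathbb{R}^d$, possibly non-convex, $f^*=\min_{x\in\mathbb{R}^d} f(x)$, and $\|\cdot\|$ is the Euclidean norm. The oracle returns stochastic gradients $\nabla f(x,\xi)$, $\xi\sim\mathcal D$. $(L_0,L_1)$-smoothness ($L_0,L_1\ge 0$): for all $x,y\in\mathbb{R}^d$ with $\|y-x\|\le 1/L_1$, $\|\nabla f(y)-\nabla f(x)\|\le (L_0+L_1\|\nabla f(x)\|)\|y-x\|$ (with $1/L_1=+\infty$ if $L_1=0$). Unbiasedness: $\mathbb{E}_\xi[\nabla f(x,\xi)]=\nabla f(x)$ for all $x$. NSGD: given $x^0\in\mathbb{R}^d$, integer batch size $B\ge1$, $\eta>0$, $\lambda>0$; at iteration $k$ draw fresh i.i.d. samples $\xi_1^k,\dots,\xi_B^k\sim\mathcal D$ (independent of the past), form $g^k=\frac1B\sum_{i=1}^B\nabla f(x^k,\xi_i^k)$, and set $x^{k+1}=x^k-\eta\,\frac{g^k}{\|g^k\|+\lambda}$. *)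

(* Defs.v *)
(* MathComp / MathComp-Analysis *)
From HB Require Import structures.
From mathcomp Require Export all_boot all_order all_algebra finmap.
From mathcomp Require Export all_classical all_reals all_analysis.
Export Order.TTheory GRing.Theory Num.Theory.
Export numFieldNormedType.Exports.

Set Implicit Arguments.
Unset Strict Implicit.
Unset Printing Implicit Defensive.

Local Open Scope classical_set_scope.
Local Open Scope ring_scope.

(* The library norm on 'rV[R]_d is the sup norm, hence an explicit Euclidean
   norm; the topology and differentiability are the same for both. *)
Definition enorm (R : realType) (d : nat) (v : 'rV[R]_d) : R :=
  Num.sqrt (\sum_(i < d) v ord0 i ^+ 2).

Definition grad (R : realType) (d : nat) (f : 'rV[R]_d -> R) (x : 'rV[R]_d) :
  'rV[R]_d := \row_(i < d) 'D_(delta_mx ord0 i : 'rV[R]_d) f x.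

(* R^d with its Borel sigma-algebra *)
Definition borel_rV (R : realType) (d : nat) :=
  g_sigma_algebraType (@open 'rV[R]_d).

(* The guard [0 < L1] encodes 1 / L1 = +oo for L1 = 0 (in MathComp 0^-1 = 0). *)
Definition L0L1_smooth (R : realType) (d : nat) (L0 L1 : R)
    (f : 'rV[R]_d -> R) : Prop :=
  forall x y : 'rV[R]_d, (0 < L1 -> enorm (y - x) <= 1 / L1) ->
    enorm (grad f y - grad f x) <= (L0 + L1 * enorm (grad f x)) * enorm (y - x).

Definition is_minimum (R : realType) (T : Type) (f : T -> R) (m : R) : Prop :=
  (exists x, f x = m) /\ (forall x, m <= f x).

(* f(x) = E_xi[F(x, xi)] *)
Definition is_expected_loss (R : realType) (d : nat) (dX : measure_display)
    (X : measurableType dX) (D : probability X R)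
    (F : 'rV[R]_d -> X -> R) (f : 'rV[R]_d -> R) : Prop :=
  forall x, D.-integrable setT (EFin \o F x) /\ ('E_D[F x] = (f x)%:E)%E.

(* The oracle output G x xi plays the role of nabla f(x, xi): it is the gradient
   of F(., xi) at x whenever the latter exists, and is otherwise arbitrary.
   Joint measurability makes the iterates random vectors. *)
Definition stochastic_gradient_oracle (R : realType) (d : nat)
    (dX : measure_display) (X : measurableType dX)
    (F : 'rV[R]_d -> X -> R) (G : 'rV[R]_d -> X -> 'rV[R]_d) : Prop :=
  (forall i : 'I_d, measurable_fun setT
     (fun z : borel_rV R d * X => G z.1 z.2 ord0 i)) /\
  (forall x xi, differentiable (F ^~ xi) x -> G x xi = grad (F ^~ xi) x).

Definition unbiased (R : realType) (d : nat) (dX : measure_display)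
    (X : measurableType dX) (D : probability X R)
    (f : 'rV[R]_d -> R) (G : 'rV[R]_d -> X -> 'rV[R]_d) : Prop :=
  forall x (i : 'I_d),
    D.-integrable setT (EFin \o (fun xi => G x xi ord0 i)) /\
    ('E_D[fun xi => G x xi ord0 i] = (grad f x ord0 i)%:E)%E.

Definition strong_growth (R : realType) (d : nat) (dX : measure_display)
    (X : measurableType dX) (D : probability X R) (p rho : R)
    (f : 'rV[R]_d -> R) (G : 'rV[R]_d -> X -> 'rV[R]_d) : Prop :=
  forall x, ('E_D[fun xi => (enorm (G x xi - grad f x) `^ p)%R]
             <= ((rho - 1) * enorm (grad f x) `^ p)%:E)%E.

Definition mutually_independent (R : realType) (dO dX : measure_display)
    (Omega : measurableType dO) (X : measurableType dX)
    (P : probability Omega R) (I : choiceType) (Y : I -> Omega -> X) : Prop :=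
  forall (J : {fset I}) (A : I -> set X), (forall j, measurable (A j)) ->
    P (\bigcap_(j in [set` J]) (Y j @^-1` A j)) =
    (\prod_(j <- J) P (Y j @^-1` A j))%E.

Definition iid (R : realType) (dO dX : measure_display)
    (Omega : measurableType dO) (X : measurableType dX)
    (P : probability Omega R) (D : probability X R)
    (I : choiceType) (Y : I -> Omega -> X) : Prop :=
  [/\ forall j, measurable_fun setT (Y j),
      forall j (A : set X), measurable A -> P (Y j @^-1` A) = D A
    & mutually_independent P Y].

Definition minibatch (R : realType) (d B : nat) (X : Type)
    (G : 'rV[R]_d -> X -> 'rV[R]_d) (x : 'rV[R]_d) (s : 'I_B -> X) : 'rV[R]_d :=
  B%:R^-1 *: \sum_(i < B) G x (s i).

(* [xi (k, i)] is the i-th sample drawn at iteration k. *)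
Fixpoint nsgd (R : realType) (d B : nat) (Omega X : Type)
    (G : 'rV[R]_d -> X -> 'rV[R]_d) (eta lambda : R) (x0 : 'rV[R]_d)
    (xi : nat * 'I_B -> Omega -> X) (k : nat) (w : Omega) : 'rV[R]_d :=
  if k is k'.+1 then
    let x := nsgd G eta lambda x0 xi k' w in
    let g := minibatch G x (fun i => xi (k', i) w) in
    x - eta *: ((enorm g + lambda)^-1 *: g)
  else x0.

(* Main.v *)
From HB Require Import structures.
Require Import Defs.
From mathcomp Require Import measurable_realfun ring lra.

Local Open Scope classical_set_scope.
Local Open Scope ring_scope.

(** Write [a] for the gradient norm at an iterate and [s] for the distance from
    the minibatch gradient to the gradient. The step size condition keeps each
    step within the radius where smoothness applies and bounds the second-order
    term of the descent inequality, so that, pathwise,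
      [f x' <= f x + eta * (- a / 2 + 2 * s + 3 / 2 * lambda)]
    ([nsgd_step_descent]).

    It remains to see that [s] has mean at most one eighth of the mean of [a]
    ([expected_minibatch_error]). Noise with a finite [p]-th moment only may have
    infinite variance, so variances cannot be added. Instead [powR_enormD_le]
    expands [enorm (S + b) `^ p] to first order around [S], with remainder
    [2 * enorm b `^ p]. When [b] is the noise of a fresh sample and [S] the sum of
    the previous ones, the linear term integrates to zero; hence the [p]-th moment
    of the sum of [B] noise vectors is at most [2 * B] times the bound
    [(rho - 1) * a ^ p] given by strong growth ([weighted_moment_sum]). After
    division by [B], the condition on the batch size says exactly that this is at
    most [(a / 8) ^ p].

    Conditioning on the past is expressed by Tonelli's theorem. The iterate and
    the partial noise sum are measurable for the sigma-algebra of the earlier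
    samples, which is independent of the next sample ([sampled_independent]), so
    the next sample may be integrated out first ([integral_freeze]). Since [a] is
    random, Jensen's inequality is used in the form of a pointwise Young
    inequality with a weight depending on the iterate.

    Taking expectations, the objective gap decreases by at least
    [eta / 4 * E a - 3 / 2 * eta * lambda] at each step; summing over [N] steps
    bounds the average of the means of [a], hence the smallest of them. The
    gradient norms are bounded along the iterations ([nsgd_grad_bounded]), which
    justifies the cancellation of their expectations. *)

(** * Euclidean geometry *)

Definition dot {R : realType} {d : nat} (u v : 'rV[R]_d) : R :=
  \sum_(i < d) u ord0 i * v ord0 i.

Section euclidean.
Set Implicit Arguments. Unset Strict Implicit.
Context {R : realType} {d : nat}.
Implicit Types (u v w : 'rV[R]_d) (c : R).

Lemma dotC u v : dot u v = dot v u.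
Proof. by apply: eq_bigr => i _; rewrite mulrC. Qed.

Lemma dotDr u v w : dot u (v + w) = dot u v + dot u w.
Proof. by rewrite -big_split; apply: eq_bigr => i _; rewrite mxE mulrDr. Qed.

Lemma dotDl u v w : dot (u + v) w = dot u w + dot v w.
Proof. by rewrite !(dotC _ w) dotDr. Qed.

Lemma dotZr c u v : dot u (c *: v) = c * dot u v.
Proof. by rewrite /dot mulr_sumr; apply: eq_bigr => i _; rewrite mxE mulrCA. Qed.

Lemma dotZl c u v : dot (c *: u) v = c * dot u v.
Proof. by rewrite dotC dotZr dotC. Qed.

Lemma dotNr u v : dot u (- v) = - dot u v.
Proof. by rewrite -scaleN1r dotZr mulN1r. Qed.

Lemma dotBl u v w : dot (u - v) w = dot u w - dot v w.
Proof. by rewrite dotDl !(dotC _ w) dotNr. Qed.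

Lemma dot0l u : dot 0 u = 0.
Proof. by rewrite -(scale0r (0 : 'rV[R]_d)) dotZl mul0r. Qed.

Lemma enorm_ge0 v : 0 <= enorm v.
Proof. exact: sqrtr_ge0. Qed.

Lemma sqr_enorm v : enorm v ^+ 2 = dot v v.
Proof. by rewrite sqr_sqrtr ?sumr_ge0// => i _; exact: sqr_ge0. Qed.

Lemma enorm0 : enorm (0 : 'rV[R]_d) = 0.
Proof. by apply/eqP; rewrite -sqrf_eq0 sqr_enorm dot0l. Qed.

Lemma enormZ c v : enorm (c *: v) = `|c| * enorm v.
Proof.
apply/eqP; rewrite -(@eqrXn2 _ 2) ?mulr_ge0 ?enorm_ge0//.
by rewrite exprMn !sqr_enorm dotZl dotZr mulrA real_normK ?num_real// expr2.
Qed.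

Lemma enormN v : enorm (- v) = enorm v.
Proof. by rewrite -scaleN1r enormZ normrN1 mul1r. Qed.

Lemma sqr_enormD u v :
  enorm (u + v) ^+ 2 = enorm u ^+ 2 + 2 * dot u v + enorm v ^+ 2.
Proof. by rewrite !sqr_enorm dotDl !dotDr (dotC v u); ring. Qed.

Lemma coord_le_enorm v i : `|v ord0 i| <= enorm v.
Proof.
rewrite -ler_sqr ?nnegrE ?enorm_ge0// sqr_enorm real_normK ?num_real//.
rewrite /dot (bigD1 i)//= -expr2 lerDl sumr_ge0// => j _.
by rewrite -expr2 sqr_ge0.
Qed.

Lemma enorm_eq0 v : enorm v = 0 -> v = 0.
Proof.
move=> v0; apply/rowP => i; rewrite mxE; apply/eqP.
by rewrite -normr_le0 -v0 coord_le_enorm.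
Qed.

(** The squared norm of [u] minus its projection on the line of [v] is
    nonnegative. *)
Lemma cauchy_schwarz u v : `|dot u v| <= enorm u * enorm v.
Proof.
have [/enorm_eq0 ->|v0] := eqVneq (enorm v) 0.
  by rewrite dotC dot0l normr0 mulr_ge0// enorm_ge0.
have v2 : 0 < enorm v ^+ 2 by rewrite exprn_gt0// lt0r v0 enorm_ge0.
rewrite -ler_sqr ?nnegrE ?mulr_ge0 ?enorm_ge0//.
rewrite real_normK ?num_real// exprMn.
have := sqr_ge0 (enorm (u - (dot u v / enorm v ^+ 2) *: v)).
rewrite sqr_enormD dotNr dotZr enormN enormZ exprMn real_normK ?num_real//.
set t := dot u v; set s := enorm v ^+ 2 in v2 *; set r := enorm u ^+ 2.
have -> : r + 2 * - (t / s * t) + (t / s) ^+ 2 * s = (r * s - t ^+ 2) / s.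
  by field; rewrite gt_eqF.
by rewrite pmulr_lge0 ?invr_gt0// subr_ge0.
Qed.

Lemma dot_le u v : dot u v <= enorm u * enorm v.
Proof. exact: le_trans (ler_norm _) (cauchy_schwarz u v). Qed.

Lemma enormD u v : enorm (u + v) <= enorm u + enorm v.
Proof.
rewrite -ler_sqr ?nnegrE ?addr_ge0 ?enorm_ge0// sqr_enormD.
by have := dot_le u v; nra.
Qed.

Lemma enormB u v : enorm u <= enorm v + enorm (u - v).
Proof. by rewrite -[X in enorm X <= _](subrK v) addrC enormD. Qed.

End euclidean.

(** * Inequalities for real powers *)

Section power_inequalities.
Set Implicit Arguments. Unset Strict Implicit.
Context {R : realType}.
Implicit Types (p q r u c : R).

(** Concavity of the power: the graph lies below its tangent at 1. With
    [u = expR t] this is the convexity of [expR] between [0] and [t]. *)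
Lemma powR_le_tangent q u : 0 <= q <= 1 -> 0 <= u -> u `^ q <= 1 + q * (u - 1).
Proof.
move=> /andP[q0 q1]; rewrite le_eqVlt => /predU1P[<-|u0].
  by rewrite /powR eqxx; case: eqVneq => [->|_] /=; lra.
have := @convex_expR R (Itv01 q0 q1) (ln u) 0.
rewrite !convRE /= /unstable.onem expR0 lnK// mulr0 addr0 mulr1.
by rewrite /powR gt_eqF//; lra.
Qed.

(** Bernoulli's inequality, obtained from the concave case by taking
    [p]-th roots. *)
Lemma powR_ge_tangent p u : 1 <= p -> 0 <= u -> 1 + p * (u - 1) <= u `^ p.
Proof.
move=> p1 u0; have p0 : 0 < p by lra.
have pV : 0 <= p^-1 <= 1 by rewrite invr_ge0 ltW//= invf_le1.
have := powR_le_tangent pV (powR_ge0 u p).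
rewrite -powRrM mulfV ?gt_eqF// powRr1// -(ler_pM2l p0) mulrDr mulrA mulfV ?gt_eqF//.
lra.
Qed.

(** The case [enorm a = 1] of [powR_enormD_le], where [c] stands for the inner
    product and [r] for the norm of [b]. The power [p / 2] is concave, so it lies
    below any of its tangents: the tangent at [1] is good enough for [r <= 1],
    where [r ^+ 2 <= r `^ p], and the tangent at [r ^+ 2] for [1 < r]. *)
Lemma powR_one_plus_le p c r : 1 <= p <= 2 -> 0 <= r -> `|c| <= r ->
  (1 + 2 * c + r ^+ 2) `^ (p / 2) <= 1 + p * c + 2 * r `^ p.
Proof.
move=> /andP[p1 p2] r0 cr; have q01 : 0 <= p / 2 <= 1 by lra.
have cr1 : - r <= c by have := lerNnormlW cr.
have base0 : 0 <= 1 + 2 * c + r ^+ 2.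
  by have := sqr_ge0 (1 - r); nra.
have [r1|r1] := leP r 1.
  apply: le_trans (powR_le_tangent q01 base0) _.
  have : r ^+ 2 <= r `^ p.
    have [->|rn0] := eqVneq r 0; first by rewrite expr0n /= powR_ge0.
    by rewrite -powR_mulrn//; apply: ger_powR => //; rewrite lt0r rn0 r0 r1.
  have := sqr_ge0 r; nra.
have r0' : 0 < r by lra.
have r2 : 0 < r ^+ 2 by rewrite exprn_gt0.
(* Factoring out [r ^+ 2] turns the tangent at [r ^+ 2] into the one at 1. *)
have -> : 1 + 2 * c + r ^+ 2 = r ^+ 2 * (1 + (1 + 2 * c) / r ^+ 2).
  by field; rewrite gt_eqF.
rewrite powRM ?sqr_ge0//; last first.
  rewrite -(pmulr_rge0 _ r2) mulrDr mulr1 mulrCA mulfV ?gt_eqF// mulr1; lra.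
rewrite -powR_mulrn// -powRrM mulrCA mulfV// mulr1 powR_mulrn//.
set P := r `^ p.
have P0 : 0 <= P by exact: powR_ge0.
have Pr : r <= P by rewrite -[leLHS]powRr1// ler_powR//; lra.
have Pr2 : P <= r ^+ 2 by rewrite -powR_mulrn// ler_powR//; lra.
have Pt : 1 + p * (r - 1) <= P by exact: powR_ge_tangent.
apply: le_trans (ler_wpM2l P0 (powR_le_tangent q01 _)) _.
  rewrite -(pmulr_rge0 _ r2) mulrDr mulr1 mulrCA mulfV ?gt_eqF// mulr1; lra.
rewrite [1 + _ - 1]addrC addKr.
set Q := P / r ^+ 2.
have QE : P = Q * r ^+ 2 by rewrite divfK// gt_eqF.
have -> : P * (1 + p / 2 * ((1 + 2 * c) / r ^+ 2)) = P + p / 2 * Q * (1 + 2 * c).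
  by rewrite /Q; field; rewrite gt_eqF.
(* [Pt] and [1 <= Q * r] give [p * r <= P + p * (Q * r)]. *)
have Q1 : Q <= 1 by rewrite ler_pdivrMr// mul1r.
have Q0 : 0 <= Q by rewrite divr_ge0// ltW.
have Qr : 1 <= Q * r.
  by rewrite -(ler_pM2r r0') mul1r -mulrA -expr2 -QE.
have h1 : 0 <= p * (1 - Q) * (c + r) by rewrite !mulr_ge0//; lra.
have h2 : p / 2 * Q <= 1 by nra.
have h3 : p <= p * (Q * r) by nra.
nra.
Qed.

(** A Taylor bound for [enorm ^ p]: the middle term is the differential at [a]
    applied to [b], and the remainder is of order [p], not 2, because the
    gradient of [enorm ^ p] is only Hoelder continuous of exponent [p - 1]. For
    [a = 0] the coefficient is a quotient by zero, but [dot a b] vanishes. The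
    linear middle term has mean zero when [b] is a centered random vector, which
    is how sums of independent noise are controlled without second moments. *)
Lemma powR_enormD_le (d : nat) p (a b : 'rV[R]_d) : 1 <= p <= 2 ->
  enorm (a + b) `^ p <=
  enorm a `^ p + p * enorm a `^ p / enorm a ^+ 2 * dot a b + 2 * enorm b `^ p.
Proof.
move=> p12; have b0 := enorm_ge0 b.
have [/enorm_eq0 ->|a0] := eqVneq (enorm a) 0.
  rewrite add0r dot0l mulr0 addr0 enorm0 powR0; last by lra.
  by have := powR_ge0 (enorm b) p; lra.
have {}a0 : 0 < enorm a by rewrite lt0r a0 enorm_ge0.
have a2 : 0 < enorm a ^+ 2 by rewrite exprn_gt0.
have abE : enorm (a + b) ^+ 2 = enorm a ^+ 2 *
    (1 + 2 * (dot a b / enorm a ^+ 2) + (enorm b / enorm a) ^+ 2).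
  by rewrite sqr_enormD; field; rewrite gt_eqF.
have rhs0 : 0 <= 1 + 2 * (dot a b / enorm a ^+ 2) + (enorm b / enorm a) ^+ 2.
  by rewrite -(pmulr_rge0 _ a2) -abE sqr_ge0.
have powE x : 0 <= x -> x `^ p = (x ^+ 2) `^ (p / 2).
  by move=> x0; rewrite -powR_mulrn// -powRrM mulrCA mulfV// mulr1.
rewrite powE ?enorm_ge0// abE powRM ?sqr_ge0// -powE ?enorm_ge0//.
have r0 : 0 <= enorm b / enorm a by rewrite divr_ge0// enorm_ge0.
have := @powR_one_plus_le p (dot a b / enorm a ^+ 2) _ p12 r0 _.
rewrite normrM normfV (ger0_norm (sqr_ge0 _)) ler_pdivrMr//.
rewrite (_ : enorm b / enorm a * _ = enorm a * enorm b); last first.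
  by field; rewrite gt_eqF.
move=> /(_ (cauchy_schwarz _ _)) /(ler_wpM2l (powR_ge0 (enorm a) p)).
move=> /le_trans; apply.
rewrite !mulrDr mulr1 lerD//; first by rewrite lerD//; lra.
rewrite mulrCA ler_pM2l// -powRM// ?enorm_ge0//.
by rewrite mulrCA mulfV ?mulr1 ?gt_eqF.
Qed.

End power_inequalities.

Section scalar.
Set Implicit Arguments. Unset Strict Implicit.
Context {R : realType}.

(** Bernoulli's inequality at [8 * s / u], multiplied by [u]. The weight
    [u `^ (1 - p)] makes both terms homogeneous of degree one. *)
Lemma weighted_young (p u s : R) : 1 <= p -> 0 < u -> 0 <= s ->
  8 * s <= p^-1 * (8 `^ p * (u `^ (1 - p) * s `^ p)) + (1 - p^-1) * u.
Proof.
move=> p1 u0 s0; have p0 : 0 < p by lra.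
have v0 : 0 <= 8 * s / u by rewrite divr_ge0 ?(ltW u0)// mulr_ge0.
have := powR_ge_tangent p1 v0.
rewrite powRM ?invr_ge0 ?(ltW u0) ?mulr_ge0// powRM// -(powR_inv1 (ltW u0)) -powRrM mulN1r.
have -> : 8 `^ p * (u `^ (1 - p) * s `^ p) = u * (8 `^ p * s `^ p * u `^ (- p)).
  rewrite powRD ?(powRr1 (ltW u0)); last by rewrite (lt0r_neq0 u0) implybT.
  ring.
rewrite (powR_inv1 (ltW u0)); move: (8 `^ p * s `^ p * u `^ (- p)) => Q tangent.
have : u * (p * (8 * s / u)) <= u * (Q + (p - 1)).
  by rewrite ler_pM2l//; lra.
rewrite (_ : u * (p * _) = p * (8 * s)); last by field; rewrite gt_eqF.
have pV0 : 0 < p^-1 by rewrite invr_gt0.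
move=> /(ler_wpM2l (ltW pV0)); rewrite mulKf ?gt_eqF//.
move=> /le_trans; apply; rewrite le_eqVlt; apply/orP; left; apply/eqP.
by field; rewrite gt_eqF.
Qed.

(** The hypothesis on the batch size [b] raised to the power [p - 1]; the
    exponent [3 * p + 1] accounts for [8 `^ p] and for the factor [2] of
    [powR_enormD_le]. *)
Lemma batch_size_bound (p rho b : R) : 1 < p -> 1 <= rho -> 0 < b ->
  2 `^ ((3 * p + 1) / (p - 1)) * (rho - 1) `^ (1 / (p - 1)) <= b ->
  8 `^ p * (2 * (rho - 1) * b) <= b `^ p.
Proof.
move=> p1 rho1 b0 bB; have q0 : 0 < p - 1 by lra.
have : (2 `^ ((3 * p + 1) / (p - 1)) * (rho - 1) `^ (1 / (p - 1))) `^ (p - 1)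
    <= b `^ (p - 1).
  by apply: ge0_ler_powR; rewrite ?nnegrE ?mulr_ge0 ?powR_ge0// ltW.
rewrite powRM ?powR_ge0// -!powRrM !divfK ?gt_eqF// powRr1 ?subr_ge0//.
rewrite [2 `^ _]powRD ?powRr1//; last by rewrite pnatr_eq0 implybT.
rewrite powRrM powR_mulrn// (_ : 2 ^+ 3 = 8); last by rewrite !exprS expr0; lra.
rewrite -(mulr_powRB1 (ltW b0) (lt_trans ltr01 p1)) -(ler_pM2l b0).
by apply: le_trans; rewrite le_eqVlt; apply/orP; left; apply/eqP; ring.
Qed.

End scalar.

(** * Descent for (L0, L1)-smooth functions *)

Section smoothness.
Set Implicit Arguments. Unset Strict Implicit.
Context {R : realType} {d : nat}.
Variable f : 'rV[R]_d -> R.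
Implicit Types (x y v g : 'rV[R]_d) (t eta lambda : R).

Lemma deriveE_dot_grad x v : differentiable f x -> 'D_v f x = dot (grad f x) v.
Proof.
move=> df; rewrite deriveE// [in LHS](row_sum_delta v) linear_sum.
by apply: eq_bigr => i _; rewrite linearZ mxE deriveE// mulrC.
Qed.

Lemma is_derive_along_line x v t : differentiable f (t *: v + x) ->
  is_derive t (1 : R) (fun s : R => f (s *: v + x)) (dot (grad f (t *: v + x)) v).
Proof.
move=> df.
(* Both derivatives are limits of the same difference quotient. *)
have lineE :
    (fun h : R => h^-1 *: (f ((h *: 1 + t) *: v + x) - f (t *: v + x)))
    = (fun h : R => h^-1 *: (f (h *: v + (t *: v + x)) - f (t *: v + x))).
  by apply/funext => h; rewrite scalerDl addrA /GRing.scale /= mulr1.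
have /cvg_ex [l fl] := diff_derivable (v := v) df.
have D1 : derivable (fun s : R => f (s *: v + x)) t 1.
  by apply/cvg_ex; exists l; rewrite /= lineE.
have -> : dot (grad f (t *: v + x)) v = 'D_1 (fun s : R => f (s *: v + x)) t.
  by rewrite -deriveE_dot_grad// /derive lineE.
exact: derivableP.
Qed.

(** Along the segment from [x] to [v + x], the function minus its quadratic upper
    model has a nonpositive derivative, by Cauchy-Schwarz and smoothness. *)
Lemma L0L1_descent (L0 L1 : R) x v : (forall y, differentiable f y) ->
  L0L1_smooth L0 L1 f -> (0 < L1 -> enorm v <= 1 / L1) ->
  f (v + x) <= f x + dot (grad f x) v
               + (L0 + L1 * enorm (grad f x)) / 2 * enorm v ^+ 2.
Proof.
move=> df fL vL; set K := L0 + L1 * enorm (grad f x); set c := dot (grad f x) v.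
pose psi t := f (t *: v + x) - c * t - K / 2 * enorm v ^+ 2 * t ^+ 2.
have dpsi t : is_derive t (1 : R) psi
    (dot (grad f (t *: v + x)) v - c - K * enorm v ^+ 2 * t).
  have := is_derive_along_line (df (t *: v + x)) => dphi.
  apply: is_derive_eq.
  by rewrite /GRing.scale /= !mulr1; field.
suff : psi 1 <= psi 0.
  by rewrite /psi !scale1r scale0r add0r !(mulr0, mulr1, expr0n, expr1n)/=; lra.
apply: (@ler0_derive1_nincr _ psi 0 1) => //.
- move=> t t01; rewrite derive1E derive_val.
  move: t01; rewrite in_itv/= => /andP[t0 t1].
  have tv : enorm (t *: v + x - x) = t * enorm v by rewrite addrK enormZ gtr0_norm.
  have near_x : 0 < L1 -> enorm (t *: v + x - x) <= 1 / L1.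
    by rewrite tv => /vL; apply: le_trans; rewrite ler_piMl// ?enorm_ge0 ?ltW.
  have := fL _ _ near_x; rewrite tv => H.
  rewrite -dotBl; have := dot_le (grad f (t *: v + x) - grad f x) v.
  have := ler_wpM2r (enorm_ge0 v) H; rewrite -/K; lra.
- apply: continuous_subspaceT => t.
  by apply/differentiable_continuous/derivable1_diffP; case: (dpsi t).
Qed.

Lemma gradient_growth (L0 L1 : R) x v : L0L1_smooth L0 L1 f ->
  (0 < L1 -> enorm v <= 1 / L1) ->
  enorm (grad f (v + x))
    <= enorm (grad f x) + (L0 + L1 * enorm (grad f x)) * enorm v.
Proof.
move=> fL vL; have := fL x (v + x); rewrite addrK => /(_ vL) H.
by apply: le_trans (enormB _ (grad f x)) _; rewrite lerD2l.
Qed.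

Definition nsgd_step eta lambda x g := x - eta *: ((enorm g + lambda)^-1 *: g).

Lemma nsgd_step_length eta lambda g : 0 < eta -> 0 < lambda ->
  enorm (- (eta *: ((enorm g + lambda)^-1 *: g)))
    = eta * (enorm g / (enorm g + lambda)).
Proof.
move=> eta0 l0; have g0 := enorm_ge0 g.
rewrite enormN !enormZ normfV !gtr0_norm ?ltr_wpDl//.
by rewrite [_^-1 * _]mulrC.
Qed.

(** A step is shorter than [eta], and the step size condition bounds [eta] by
    [1 / L1], so that smoothness applies between consecutive iterates. *)
Lemma nsgd_step_small (L0 L1 : R) eta lambda g :
  0 <= L0 -> 0 < eta -> 0 < lambda -> eta * (L0 + L1 * lambda) <= lambda ->
  0 < L1 -> enorm (- (eta *: ((enorm g + lambda)^-1 *: g))) <= 1 / L1.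
Proof.
move=> L00 eta0 l0 etaL L1p; have h0 := enorm_ge0 g.
have hl0 : 0 < enorm g + lambda by rewrite ltr_wpDl.
rewrite nsgd_step_length// ler_pdivlMr//.
have etaL1 : eta * L1 <= 1.
  by rewrite -(ler_pM2r l0) mul1r; apply: le_trans etaL; nra.
apply: le_trans etaL1; rewrite (ler_wpM2r (ltW L1p))// ler_piMr ?(ltW eta0)//.
by rewrite ler_pdivrMr// mul1r lerDl ltW.
Qed.

(** The deterministic progress of one step, for an arbitrary direction [g] in
    place of the minibatch gradient. Write [a], [h] and [s] for the norms of the
    gradient, of [g] and of their difference, and [q = h / (h + lambda)]. The
    first-order term is at most [- h * q + s * q <= - a + lambda + 2 * s], and
    the step size condition makes the second-order term at most
    [(lambda + a) / 2], both up to the factor [eta]. *)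
Lemma nsgd_step_descent (L0 L1 : R) eta lambda x g :
  (forall y, differentiable f y) -> L0L1_smooth L0 L1 f ->
  0 <= L0 -> 0 <= L1 -> 0 < eta -> 0 < lambda ->
  eta * (L0 + L1 * lambda) <= lambda ->
  f (nsgd_step eta lambda x g) <=
  f x + eta * (- (enorm (grad f x) / 2) + 2 * enorm (g - grad f x)
               + 3 / 2 * lambda).
Proof.
move=> df fL L00 L10 eta0 l0 etaL.
set a := enorm (grad f x); set s := enorm (g - grad f x).
set h := enorm g; set q := h / (h + lambda).
have a0 : 0 <= a := enorm_ge0 _; have s0 : 0 <= s := enorm_ge0 _.
have h0 : 0 <= h := enorm_ge0 _; have hl0 : 0 < h + lambda by rewrite ltr_wpDl.
have q0 : 0 <= q by rewrite divr_ge0// ltW.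
have q1 : q <= 1 by rewrite ler_pdivrMr// mul1r lerDl ltW.
have etaL1 : eta * L1 <= 1.
  by rewrite -(ler_pM2r l0) mul1r; apply: le_trans etaL; nra.
have := L0L1_descent x df fL (nsgd_step_small g L00 eta0 l0 etaL).
rewrite addrC -/(nsgd_step _ _ _ _) nsgd_step_length//.
rewrite dotNr !dotZr -/a -/h -/q => desc.
have dotE : dot (grad f x) g = h ^+ 2 - dot (g - grad f x) g.
  by rewrite dotBl -sqr_enorm -/h; lra.
have errle : dot (g - grad f x) g <= s * h := dot_le _ _.
have ah : a <= h + s.
  rewrite /s -[enorm (g - _)]enormN opprB; exact: enormB.
have first_order : - ((h + lambda)^-1 * dot (grad f x) g) <= - a + lambda + 2 * s.
  have -> : - ((h + lambda)^-1 * dot (grad f x) g)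
      = (h + lambda)^-1 * dot (g - grad f x) g - h * q.
    by rewrite dotE /q; field; rewrite gt_eqF.
  have : (h + lambda)^-1 * dot (g - grad f x) g <= s * q.
    by rewrite /q mulrA [leRHS]mulrC ler_pM2l ?invr_gt0.
  have qE : h * q = h - lambda * q by rewrite /q; field; rewrite gt_eqF.
  have := ler_piMr s0 q1; have := ler_piMr (ltW l0) q1; lra.
have curv : eta * (L0 + L1 * a) <= lambda + a.
  have : eta * L0 <= lambda.
    by apply: le_trans etaL; rewrite ler_pM2l// lerDl mulr_ge0// ltW.
  by have := ler_wpM2r a0 etaL1; lra.
have second_order : (L0 + L1 * a) / 2 * (eta * q) ^+ 2 <= eta * ((lambda + a) / 2).
  have q2 : q ^+ 2 <= 1 by rewrite expr_le1.
  have -> : (L0 + L1 * a) / 2 * (eta * q) ^+ 2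
      = eta * (eta * (L0 + L1 * a) / 2 * q ^+ 2) by ring.
  rewrite ler_pM2l//; have := sqr_ge0 q; nra.
apply: (le_trans desc).
have := ler_wpM2l (ltW eta0) first_order; lra.
Qed.

End smoothness.

Section bounded_gradient.
Set Implicit Arguments. Unset Strict Implicit.
Context {R : realType} {d B : nat} {Omega X : Type}.
Variables (f : 'rV[R]_d -> R) (G : 'rV[R]_d -> X -> 'rV[R]_d).
Variables (L0 L1 eta lambda : R) (x0 : 'rV[R]_d) (xi : nat * 'I_B -> Omega -> X).

(** Steps have length at most [eta], so the gradient norm is at most an affine
    function of its previous value, whatever the samples. This makes the
    expected gradient norms finite, hence cancellable in the extended reals. *)
Lemma nsgd_grad_bounded k :
  L0L1_smooth L0 L1 f -> 0 <= L0 -> 0 <= L1 -> 0 < eta -> 0 < lambda ->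
  eta * (L0 + L1 * lambda) <= lambda ->
  exists M, forall w, enorm (grad f (nsgd G eta lambda x0 xi k w)) <= M.
Proof.
move=> fL L00 L10 eta0 l0 etaL; elim: k => [|k [M bounded]] /=.
  by exists (enorm (grad f x0)).
exists (M + (L0 + L1 * M) * eta) => w.
set x := nsgd _ _ _ _ _ _ _; set g := minibatch _ _ _.
have aM : enorm (grad f x) <= M by exact: bounded.
have a0 := enorm_ge0 (grad f x).
have := gradient_growth x fL (nsgd_step_small g L00 eta0 l0 etaL).
rewrite addrC => /le_trans; apply; rewrite lerD// ler_pM ?enorm_ge0//.
- by rewrite addr_ge0// mulr_ge0.
- by rewrite lerD2l ler_wpM2l.
rewrite nsgd_step_length// ler_piMr ?(ltW eta0)// ler_pdivrMr; last first.
  by rewrite ltr_wpDl// enorm_ge0.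
by rewrite mul1r lerDl ltW.
Qed.

End bounded_gradient.

Section gradient_continuity.
Set Implicit Arguments. Unset Strict Implicit.
Context {R : realType} {d : nat}.

Lemma enorm_continuous : continuous (@enorm R d).
Proof.
move=> v; apply: (@continuous_comp _ _ _
  (fun v : 'rV[R]_d => \sum_(i < d) v ord0 i ^+ 2) Num.sqrt).
  apply: continuous_big; first exact: add_continuous.
  move=> i _ {}v; apply: (@continuous_comp _ _ _
    (fun v : 'rV[R]_d => v ord0 i) (fun x => x ^+ 2)).
    exact: coord_continuous.
  exact: exprn_continuous.
exact: sqrt_continuous.
Qed.

(** Smoothness is a Lipschitz bound on a neighbourhood of each point, with a
    constant depending on the point. *)
Lemma L0L1_grad_continuous (L0 L1 : R) (f : 'rV[R]_d -> R) i :
  L0L1_smooth L0 L1 f -> continuous (fun x => grad f x ord0 i).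
Proof.
move=> fL; suff cvg_at (x : 'rV[R]_d) :
    grad f y ord0 i @[y --> x] --> grad f x ord0 i.
  by move=> x; exact: cvg_at.
have Fx : Filter (nbhs x) := nbhs_filter x.
set K := L0 + L1 * enorm (grad f x).
have dist0 : enorm (y - x) @[y --> x] --> (0 : R).
  have : {for x, continuous (@enorm R d \o (fun y : 'rV[R]_d => y - x))}.
    apply: continuous_comp; last exact: enorm_continuous.
    by apply: (@cvgB _ _ _ (nbhs x) _ id (cst x)); [exact: cvg_id|exact: cvg_cst].
  by rewrite /prop_for /continuous_at /comp /= subrr enorm0.
have scaled0 (c : R) : c * enorm (y - x) @[y --> x] --> (0 : R).
  rewrite -(mulr0 c).
  apply: (@cvgM _ _ (nbhs x) _ (cst c) (fun y => enorm (y - x))) => //.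
  exact: cvg_cst.
apply/cvgrPdist_lt => e e0.
move/cvgrPdist_lt : (scaled0 L1) => /(_ _ ltr01).
move/cvgrPdist_lt : (scaled0 K) => /(_ _ e0).
apply: filterS2 => y; rewrite !sub0r !normrN => Kdist L1dist.
have near_xy : 0 < L1 -> enorm (y - x) <= 1 / L1.
  move=> L1p; rewrite ler_pdivlMr// mulrC ltW//.
  by apply: le_lt_trans L1dist; exact: ler_norm.
have := coord_le_enorm (grad f y - grad f x) i; rewrite distrC !mxE.
move=> /le_trans /(_ (fL _ _ near_xy)) /le_lt_trans; apply.
by apply: le_lt_trans Kdist; exact: ler_norm.
Qed.

End gradient_continuity.

(** * Measurability of vector-valued functions *)

Section borel_vectors.
Set Implicit Arguments. Unset Strict Implicit.
Context {R : realType} {d : nat}.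

Definition rational_box (c : 'rV[rat]_d) (n : nat) : set 'rV[R]_d :=
  [set v | forall i, `|v ord0 i - ratr (c ord0 i)| < n.+1%:R^-1].

Lemma exists_half_radius (e : R) : 0 < e ->
  exists n : nat, n.+1%:R^-1 + n.+1%:R^-1 < e.
Proof.
move=> e0; have [|n] := @ltr_add_invr R 0 (e / 2); first by rewrite divr_gt0.
by rewrite add0r => ne; exists n; rewrite [ltRHS]splitr ltrD.
Qed.

Lemma exists_rat_near (x e : R) : 0 < e -> exists q : rat, `|x - ratr q| < e.
Proof.
move=> e0; have [|q] := @rat_in_itvoo R (x - e) (x + e); first by lra.
rewrite in_itv/= => /andP[q1 q2]; exists q.
by rewrite ltr_norml; apply/andP; split; lra.
Qed.

(** The rational boxes are a countable base of the topology; countability is what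
    reduces measurability for the Borel sets to measurability of coordinates. *)
Lemma rational_box_base (U : set 'rV[R]_d) v : open U -> U v ->
  exists c n, rational_box c n v /\ rational_box c n `<=` U.
Proof.
rewrite openE => /(_ v) /[apply] /nbhs_ballP [e e0 eU].
have [n ne] := exists_half_radius e0.
have n0 : (0 : R) < n.+1%:R^-1 by rewrite invr_gt0.
have near_rat i := exists_rat_near (v ord0 i) n0.
exists (\row_i sval (cid (near_rat i))), n; split=> [i|w wbox].
  by rewrite mxE; case: cid.
apply: eU; split=> // i j; rewrite ord1 /ball/=.
have := wbox j; rewrite mxE; case: cid => q /= vq wq.
rewrite (_ : _ - _ = (v ord0 j - ratr q) - (w ord0 j - ratr q)).
  by apply: le_lt_trans (ler_normB _ _) _; apply: lt_trans ne; rewrite ltrD.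
by rewrite opprB addrA subrK.
Qed.

Lemma measurable_fun_borel_rV (dT : measure_display) (T : measurableType dT)
    (h : T -> borel_rV R d) :
  (forall i, measurable_fun setT (fun w => (h w : 'rV[R]_d) ord0 i)) ->
  measurable_fun setT h.
Proof.
move=> mh; apply: (@measurability _ _ T (borel_rV R d) setT h
  (@open 'rV[R]_d) erefl) => _ [U oU <-].
(* [U] is the union of the rational boxes that it contains. *)
rewrite setTI (_ : h @^-1` U = \bigcup_(cn : 'rV[rat]_d * nat)
   (h @^-1` [set v | rational_box cn.1 cn.2 v
                     /\ rational_box cn.1 cn.2 `<=` U])).
  apply: countable_bigcupT_measurable; first exact: countableP.
  move=> [c n] /=; have [cnU|cnU] := pselect (rational_box c n `<=` U); last first.
    by rewrite (_ : _ @^-1` _ = set0)// -subset0 => w [].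
  rewrite (_ : _ @^-1` _ = \bigcap_(i : 'I_d)
      ((fun w => (h w : 'rV[R]_d) ord0 i - ratr (c ord0 i))
         @^-1` (ball 0 n.+1%:R^-1))).
    apply: fin_bigcap_measurable => // i _; rewrite -[X in measurable X]setTI.
    apply: measurable_funB => //.
    exact: measurable_ball.
  apply/seteqP; split=> w /=.
    by move=> [wb _] i _ /=; rewrite /ball/= sub0r normrN; exact: wb.
  move=> wb; split=> // i; have := wb i Logic.I.
  by rewrite /ball/= sub0r normrN.
apply/seteqP; split=> w /=.
  move=> /(rational_box_base oU)[c [n [wcn cnU]]].
  by exists (c, n).
by move=> [[c n] _ /= [wcn]]; exact.
Qed.

Lemma continuous_borel_rV_measurable (h : 'rV[R]_d -> R) :
  continuous h -> measurable_fun setT (h : borel_rV R d -> R).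
Proof.
move=> ch; apply: (measurability _ (RGenOpens.measurableE R)).
move=> _ [_ [a [b ->] <-]]; rewrite setTI; apply: sub_sigma_algebra.
by apply: open_comp => //; exact: interval_open.
Qed.

Lemma measurable_coord i :
  measurable_fun setT (fun v : borel_rV R d => (v : 'rV[R]_d) ord0 i).
Proof. by apply: continuous_borel_rV_measurable; exact: coord_continuous. Qed.

End borel_vectors.

Section measurable_vectors.
Set Implicit Arguments. Unset Strict Implicit.
Context {R : realType} {d : nat} {dT : measure_display} {T : measurableType dT}.
Implicit Types (u v : T -> 'rV[R]_d).

(** Coordinatewise measurability, which is convenient for vector arithmetic;
    [measurable_rVP] identifies it with Borel measurability. *)
Definition measurable_rV u := forall i, measurable_fun setT (fun w => u w ord0 i).

Lemma measurable_rVP u :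
  measurable_rV u <-> measurable_fun setT (u : T -> borel_rV R d).
Proof.
split=> [mu|mu i]; first exact: measurable_fun_borel_rV.
exact: measurableT_comp (measurable_coord i) mu.
Qed.

Lemma measurable_rVD u v :
  measurable_rV u -> measurable_rV v -> measurable_rV (fun w => u w + v w).
Proof.
move=> mu mv i; rewrite (_ : (fun w => _) = (fun w => u w ord0 i + v w ord0 i)).
  exact: measurable_funD (mu i) (mv i).
by apply/funext => w; rewrite mxE.
Qed.

Lemma measurable_rVB u v :
  measurable_rV u -> measurable_rV v -> measurable_rV (fun w => u w - v w).
Proof.
move=> mu mv i; rewrite (_ : (fun w => _) = (fun w => u w ord0 i - v w ord0 i)).
  exact: measurable_funB (mu i) (mv i).
by apply/funext => w; rewrite !mxE.
Qed.

Lemma measurable_rVZ (c : T -> R) u :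
  measurable_fun setT c -> measurable_rV u -> measurable_rV (fun w => c w *: u w).
Proof.
move=> mc mu i; rewrite (_ : (fun w => _) = (fun w => c w * u w ord0 i)).
  exact: measurable_funM mc (mu i).
by apply/funext => w; rewrite mxE.
Qed.

Lemma measurable_rV_sum (I : Type) (s : seq I) (P : pred I) (u : I -> T -> 'rV[R]_d) :
  (forall j, P j -> measurable_rV (u j)) ->
  measurable_rV (fun w => \sum_(j <- s | P j) u j w).
Proof.
move=> mu; elim: s => [|j s IH] i.
  rewrite (_ : (fun w => _) = fun=> 0); first exact: measurable_cst.
  by apply/funext => w; rewrite big_nil mxE.
have [Pj|Pj] := boolP (P j); last first.
  under eq_fun do rewrite big_cons (negbTE Pj).
  exact: IH.
under eq_fun do rewrite big_cons Pj.
exact: measurable_rVD (mu j Pj) IH i.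
Qed.

Lemma measurable_enorm u :
  measurable_rV u -> measurable_fun setT (fun w => enorm (u w)).
Proof.
move=> mu; have msqrt : measurable_fun setT (@Num.sqrt R).
  by apply: continuous_measurable_fun; exact: sqrt_continuous.
apply: (measurableT_comp msqrt).
by apply: measurable_sum => i; exact: measurable_funX.
Qed.

Lemma measurable_powRc (h : T -> R) (p : R) : measurable_fun setT h ->
  measurable_fun setT (fun w => h w `^ p).
Proof. by move=> mh; exact: (measurableT_comp (measurable_powR p) mh). Qed.

End measurable_vectors.

(** * Independence of a sample from the past *)

Section freezing.
Set Implicit Arguments. Unset Strict Implicit.
Context {R : realType} {dO dX dT : measure_display}.
Context {Omega : measurableType dO} {X : measurableType dX} {T : measurableType dT}.
Variables (P : probability Omega R) (D : probability X R).

(** When [Z] has law [D] and is independent of [Y], the joint law of [(Y, Z)] is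
    a product measure, so Tonelli's theorem integrates [Z] out with [Y] frozen.
    This plays the role of conditioning on [Y]. *)
Lemma integral_freeze (Y : Omega -> T) (Z : Omega -> X) (h : T * X -> \bar R) :
  measurable_fun setT Y -> measurable_fun setT Z ->
  (forall A C, measurable A -> measurable C ->
     P (Y @^-1` A `&` Z @^-1` C) = (P (Y @^-1` A) * D C)%E) ->
  measurable_fun setT h -> (forall z, (0 <= h z)%E) ->
  (\int[P]_w h (Y w, Z w) = \int[P]_w \int[D]_z h (Y w, z))%E.
Proof.
move=> mY mZ indep mh h0.
pose Y' : {mfun Omega >-> T} := HB.pack Y (isMeasurableFun.Build _ _ _ _ _ mY).
have mYZ : measurable_fun setT (fun w => (Y w, Z w)) by exact: measurable_fun_pair.
pose YZ : {mfun Omega >-> (T * X)%type} :=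
  HB.pack (fun w => (Y w, Z w)) (isMeasurableFun.Build _ _ _ _ _ mYZ).
have -> : (\int[P]_w h (Y w, Z w) = \int[distribution P YZ]_u h u)%E.
  by rewrite ge0_integral_distribution.
have -> : (\int[distribution P YZ]_u h u = \int[distribution P Y' \x D]_u h u)%E.
  apply: eq_measure_integral => A mA _; apply/esym.
  by apply: product_measure_unique => // B C mB mC; rewrite -indep.
rewrite fubini_tonelli1// ge0_integral_distribution//.
  exact: measurable_fun_fubini_tonelli_F.
by move=> x; exact: integral_ge0.
Qed.

End freezing.

Section past.
Set Implicit Arguments. Unset Strict Implicit.
Context {R : realType} {dO dX : measure_display}.
Context {Omega : measurableType dO} {X : measurableType dX}.
Variables (P : probability Omega R) (D : probability X R).
Context {I : choiceType}.
Variable xi : I -> Omega -> X.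
Hypothesis hxi : iid P D xi.

(** The events that constrain the samples of index in [J] separately. They form
    a pi-system generating the sigma-algebra of these samples. *)
Definition sample_cylinders (J : {fset I}) : set (set Omega) :=
  [set E | exists2 A : I -> set X, (forall j, measurable (A j)) &
     E = \bigcap_(j in [set` J]) (xi j @^-1` A j)].

(** [Omega] with the coarser sigma-algebra generated by the samples of index in
    [J], so that [measurable_fun] out of it means depending measurably on these
    samples only. *)
Definition sampled (J : {fset I}) := g_sigma_algebraType (sample_cylinders J).

Let mxi j : measurable_fun setT (xi j).
Proof. by have [] := hxi. Qed.

Let mxiA j (A : set X) : measurable A -> measurable (xi j @^-1` A).
Proof. by move=> mA; rewrite -[X in measurable X]setTI; exact: mxi. Qed.

Lemma sample_cylinders_measurable J : sample_cylinders J `<=` measurable.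
Proof.
move=> _ [A mA ->]; apply: fin_bigcap_measurable; first exact: finite_fset.
by move=> j _; exact: mxiA.
Qed.

Lemma measurable_sampled J j : j \in J ->
  measurable_fun setT (xi j : sampled J -> X).
Proof.
move=> jJ _ A mA; rewrite setTI; apply: sub_sigma_algebra.
exists (fun i => if i == j then A else setT) => [i|]; first by case: ifP.
apply/seteqP; split=> [w Aw i _ /=|w /(_ j jJ) /=]; last by rewrite eqxx.
by case: eqP => // ->.
Qed.

(** As functions of [E], both sides are finite measures; they agree on the
    pi-system of cylinders by mutual independence, hence on the sigma-algebra
    that it generates. *)
Lemma sampled_independent J j (E : set Omega) (C : set X) : j \notin J ->
  measurable (E : set (sampled J)) -> measurable C ->
  P (E `&` xi j @^-1` C) = (P E * D C)%E.
Proof.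
move=> jJ mE mC; have [_ lawD indep] := hxi.
have DC : (D C = (fine (D C))%:E) by rewrite fineK// fin_num_measure.
have DC0 : 0 <= fine (D C) by rewrite fine_ge0.
pose m1 := mrestr P (mxiA j mC).
pose m2 := mscale (NngNum DC0) P.
rewrite muleC.
have m2E A : m2 A = ((fine (D C))%:E * P A)%E by [].
have -> : (D C * P E = m2 E)%E by rewrite m2E -DC.
apply: (@g_sigma_algebra_measure_unique _ _ _ (sample_cylinders J) _
  (fun=> setT) _ _ m1 m2) => //.
- exact: sample_cylinders_measurable.
- move=> _; exists (fun=> setT) => //.
  by apply/seteqP; split=> // w _ i _.
- by apply/seteqP; split=> // w _; exists 0%N.
- move=> _ _ [A mA ->] [B mB ->]; exists (fun i => A i `&` B i) => [i|].
    exact: measurableI.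
  apply/seteqP; split=> w.
    by move=> [wA wB] i iJ; split; [exact: wA|exact: wB].
  by move=> wAB; split=> i iJ; have [] := wAB i iJ.
- move=> _ [A mA ->].
  (* The cylinder intersected with the new event is a cylinder over [j |` J]. *)
  pose A' i := if i == j then C else A i.
  have mA' i : measurable (A' i) by rewrite /A'; case: ifP.
  have A'j i : i \in J -> A' i = A i.
    by move=> iJ; rewrite /A'; case: eqP => // ij; rewrite -ij iJ in jJ.
  transitivity (D C * P (\bigcap_(i in [set` J]) (xi i @^-1` A i)))%E; last first.
    exact: (congr1 (fun c => c * P _)%E DC).
  have -> : (D C * P (\bigcap_(i in [set` J]) (xi i @^-1` A i)))%E
      = P (\bigcap_(i in [set` (j |` J)%fset]) (xi i @^-1` A' i)).
    rewrite !indep// big_fsetU1//= {1}/A' eqxx lawD//; congr (_ * _)%E.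
    by apply: eq_big_seq => i iJ; rewrite A'j.
  congr (P _); apply/seteqP; split=> w.
    move=> [wA wC] i; rewrite /= !inE /A' => /orP[/eqP ->|iJ]; first by rewrite eqxx.
    by case: eqP => [->//|_]; exact: wA.
  move=> wA'; split=> [i iJ|].
    by have := wA' i; rewrite /= A'j//; apply; rewrite !inE iJ orbT.
  by have := wA' j; rewrite /= /A' eqxx; apply; rewrite !inE eqxx.
- move=> k; apply: (@le_lt_trans _ _ (P setT)).
    2: by rewrite probability_setT ltry.
  by apply: le_measure; rewrite ?inE//; apply: measurableI => //; exact: mxiA.
Qed.

End past.

(** * Moments of the minibatch error *)

Section moments.
Set Implicit Arguments. Unset Strict Implicit.
Context {R : realType} {dX : measure_display} {X : measurableType dX}.
Variable D : probability X R.

Lemma expectation_dot_centered (d : nat) (S : 'rV[R]_d) (zeta : X -> 'rV[R]_d) :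
  (forall i, D.-integrable setT (EFin \o (fun z => zeta z ord0 i))) ->
  (forall i, ('E_D[fun z => zeta z ord0 i] = 0)%E) ->
  D.-integrable setT (EFin \o (fun z => dot S (zeta z))) /\
  (\int[D]_z (dot S (zeta z))%:E = 0)%E.
Proof.
move=> int0 mean0.
have intc i : D.-integrable setT (fun z => ((S ord0 i)%:E * (zeta z ord0 i)%:E)%E).
  exact: integrableZl (int0 i).
have dotE : (fun z => (dot S (zeta z))%:E)
    = (fun z => \sum_(i <- index_enum 'I_d) ((S ord0 i)%:E * (zeta z ord0 i)%:E)%E).
  by apply/funext => z; rewrite /dot sumEFin.
split; first by rewrite /comp dotE; exact: integrable_sum.
rewrite dotE integral_sum//; apply: big1 => i _.
rewrite (integralZl measurableT (int0 i)).
by have := mean0 i; rewrite unlock => ->; rewrite mule0.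
Qed.

(** Integrating the Taylor bound [powR_enormD_le]: the linear term vanishes. *)
Lemma moment_add_centered (d : nat) (p V : R) (S : 'rV[R]_d) (zeta : X -> 'rV[R]_d) :
  1 <= p <= 2 ->
  (forall i, D.-integrable setT (EFin \o (fun z => zeta z ord0 i))) ->
  (forall i, ('E_D[fun z => zeta z ord0 i] = 0)%E) ->
  (\int[D]_z (enorm (zeta z) `^ p)%:E <= V%:E)%E ->
  (\int[D]_z (enorm (S + zeta z) `^ p)%:E <= (enorm S `^ p + 2 * V)%:E)%E.
Proof.
move=> p12 int0 mean0 momV.
have mzeta : measurable_rV zeta.
  by move=> i; apply/measurable_EFinP; case/integrableP: (int0 i).
have mpow : measurable_fun setT (fun z => enorm (zeta z) `^ p).
  by apply: measurable_powRc; exact: measurable_enorm.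
have mS : measurable_rV (fun z => S + zeta z).
  by apply: measurable_rVD => // i; exact: measurable_cst.
set c := p * enorm S `^ p / enorm S ^+ 2.
have [intdot dot0] := expectation_dot_centered S int0 mean0.
have intpow : D.-integrable setT (fun z => (enorm (zeta z) `^ p)%:E).
  apply/integrableP; split; first exact/measurable_EFinP.
  apply: le_lt_trans (ltry V); apply: le_trans momV; rewrite le_eqVlt; apply/orP; left.
  by apply/eqP/eq_integral => z _; rewrite gee0_abs// lee_fin powR_ge0.
have intcst : D.-integrable setT (fun=> (enorm S `^ p)%:E).
  exact: finite_measure_integrable_cst.
have intc : D.-integrable setT (fun z => (c%:E * (dot S (zeta z))%:E)%E).
  exact: integrableZl.
have int2 :
    D.-integrable setT (fun z => (2%:E * (enorm (zeta z) `^ p)%:E)%E).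
  exact: integrableZl.
pose bound z := (((enorm S `^ p)%:E + c%:E * (dot S (zeta z))%:E)
                  + 2%:E * (enorm (zeta z) `^ p)%:E)%E.
have intb1 : D.-integrable setT
    (fun z => ((enorm S `^ p)%:E + c%:E * (dot S (zeta z))%:E)%E).
  exact: integrableD.
apply: (@le_trans _ _ (\int[D]_z bound z)%E).
  apply: ge0_le_integral => //.
  - by move=> z _; rewrite lee_fin powR_ge0.
  - by apply/measurable_EFinP; apply: measurable_powRc; exact: measurable_enorm.
  - by have /integrableP[] := integrableD measurableT intb1 int2.
  - by move=> z _; rewrite /bound -!EFinM -!EFinD lee_fin powR_enormD_le.
rewrite /bound (integralD measurableT intb1 int2) (integralD measurableT intcst intc).
rewrite integral_cst//= probability_setT mule1.
rewrite (integralZl measurableT intdot) (integralZl measurableT intpow).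
rewrite dot0 mule0 adde0.
rewrite (_ : (_ + 2 * V)%:E = ((enorm S `^ p)%:E + 2%:E * V%:E)%E)//.
by rewrite leeD2l// lee_pmul2l// lte_fin.
Qed.

End moments.

Section nsgd_process.
Set Implicit Arguments. Unset Strict Implicit.
Context {R : realType} {d : nat} {dX : measure_display} {X : measurableType dX}.
Context {B : nat}.
Variables (G : 'rV[R]_d -> X -> 'rV[R]_d) (m : 'rV[R]_d -> 'rV[R]_d).
Variables (eta lambda : R) (x0 : 'rV[R]_d).
Hypothesis lambda0 : 0 < lambda.
Hypothesis mG : forall i : 'I_d, measurable_fun setT
  (fun z : borel_rV R d * X => G z.1 z.2 ord0 i).
Hypothesis mm : measurable_rV (m : borel_rV R d -> 'rV[R]_d).

Definition noise x z := G x z - m x.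

(** Only the first [n] samples of the batch enter, so that the noise of a
    minibatch can be built up one independent sample at a time. *)
Definition noise_sum {Omega : Type} (xi : nat * 'I_B -> Omega -> X) k n w :=
  \sum_(j < B | (j < n)%N) noise (nsgd G eta lambda x0 xi k w) (xi (k, j) w).

Section measurability.
Context {dO : measure_display} {Omega : measurableType dO}.
Variable xi : nat * 'I_B -> Omega -> X.

Lemma measurable_oracle (x : Omega -> 'rV[R]_d) (z : Omega -> X) :
  measurable_rV x -> measurable_fun setT z -> measurable_rV (fun w => G (x w) (z w)).
Proof.
move=> /measurable_rVP mx mz i.
exact: measurableT_comp (mG i) (measurable_fun_pair mx mz).
Qed.

Lemma measurable_mean (x : Omega -> 'rV[R]_d) :
  measurable_rV x -> measurable_rV (fun w => m (x w)).
Proof. by move=> /measurable_rVP mx i; exact: measurableT_comp (mm i) mx. Qed.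

Lemma measurable_nsgd k :
  (forall k' j, (k' < k)%N -> measurable_fun setT (xi (k', j))) ->
  measurable_rV (nsgd G eta lambda x0 xi k).
Proof.
elim: k => [|k IH] mxi /=; first by move=> i; exact: measurable_cst.
have mx : measurable_rV (nsgd G eta lambda x0 xi k).
  by apply: IH => k' j k'k; apply: mxi; exact: ltnW.
have mg : measurable_rV (fun w =>
    minibatch G (nsgd G eta lambda x0 xi k w) (fun i => xi (k, i) w)).
  apply: measurable_rVZ; first exact: measurable_cst.
  apply: measurable_rV_sum => j _; apply: measurable_oracle => //; exact: mxi.
apply: measurable_rVB => //; apply: measurable_rVZ; first exact: measurable_cst.
apply: measurable_rVZ => //.
(* The inverse is a power with exponent -1, hence measurable. *)
under eq_fun do rewrite -powR_inv1 ?addr_ge0 ?enorm_ge0 ?(ltW lambda0)//.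
apply: measurable_powRc; apply: measurable_funD; last exact: measurable_cst.
exact: measurable_enorm.
Qed.

Lemma measurable_noise_sum k n :
  (forall k' j, (k' < k)%N -> measurable_fun setT (xi (k', j))) ->
  (forall j : 'I_B, (j < n)%N -> measurable_fun setT (xi (k, j))) ->
  measurable_rV (noise_sum xi k n).
Proof.
move=> mpast mcur; have mx := measurable_nsgd mpast.
apply: measurable_rV_sum => j jn; apply: measurable_rVB.
  by apply: measurable_oracle => //; exact: mcur.
exact: measurable_mean.
Qed.

End measurability.

Lemma noise_sumS {Omega : Type} (xi : nat * 'I_B -> Omega -> X) k (j : 'I_B) w :
  noise_sum xi k j.+1 w
    = noise_sum xi k j w + noise (nsgd G eta lambda x0 xi k w) (xi (k, j) w).
Proof.
rewrite /noise_sum (bigD1 j)//= addrC; congr (_ + _); apply: eq_bigl => i.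
by rewrite ltnS [(i < j)%N]ltn_neqAle andbC.
Qed.

Lemma minibatch_error {Omega : Type} (xi : nat * 'I_B -> Omega -> X) k w : (0 < B)%N ->
  minibatch G (nsgd G eta lambda x0 xi k w) (fun i => xi (k, i) w)
    - m (nsgd G eta lambda x0 xi k w) = B%:R^-1 *: noise_sum xi k B w.
Proof.
move=> B0; rewrite /minibatch /noise_sum.
under [in RHS]eq_bigl do rewrite ltn_ord.
rewrite sumrB sumr_const card_ord scalerBr -[m _ *+ _]scaler_nat.
rewrite scalerA mulVf ?scale1r//.
by rewrite pnatr_eq0 -lt0n.
Qed.

(** The explicit enumeration only serves to show that this set is finite;
    [earlier_samplesP] characterizes it. *)
Definition earlier_samples k n : {fset nat * 'I_B} :=
  [fset e in [seq e : nat * 'I_B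
               <- [seq (k', j) | k' <- iota 0 k.+1, j <- enum 'I_B]
             | ((e.1 < k) || (e.2 < n))%N]]%fset.

Lemma earlier_samplesP k n (e : nat * 'I_B) :
  (e \in earlier_samples k n) = ((e.1 <= k) && ((e.1 < k) || (e.2 < n)))%N.
Proof.
case: e => k' j; rewrite !inE mem_filter andbC; congr (_ && _).
apply/allpairsP/idP => [[[k1 j1] [+ _ [-> _]]]|k'k].
  by rewrite mem_iota.
by exists (k', j); split=> //; rewrite ?mem_iota ?mem_enum.
Qed.

End nsgd_process.

Section noise_moments.
Set Implicit Arguments. Unset Strict Implicit.
Context {R : realType} {d : nat} {dX dO : measure_display}.
Context {X : measurableType dX} {Omega : measurableType dO} {B : nat}.
Variables (D : probability X R) (P : probability Omega R).
Variables (G : 'rV[R]_d -> X -> 'rV[R]_d) (m : 'rV[R]_d -> 'rV[R]_d).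
Variables (eta lambda p c : R) (x0 : 'rV[R]_d).
Variable xi : nat * 'I_B -> Omega -> X.
Hypothesis lambda0 : 0 < lambda.
Hypothesis mG : forall i : 'I_d, measurable_fun setT
  (fun z : borel_rV R d * X => G z.1 z.2 ord0 i).
Hypothesis mm : measurable_rV (m : borel_rV R d -> 'rV[R]_d).
Hypothesis p12 : 1 <= p <= 2.
Hypothesis c0 : 0 <= c.
Hypothesis noise_int : forall x i,
  D.-integrable setT (EFin \o (fun z => noise G m x z ord0 i)).
Hypothesis noise_mean : forall x i, ('E_D[fun z => noise G m x z ord0 i] = 0)%E.
Hypothesis noise_moment : forall x,
  (\int[D]_z (enorm (noise G m x z) `^ p)%:E <= (c * enorm (m x) `^ p)%:E)%E.
Hypothesis hxi : iid P D xi.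

Let iter k := nsgd G eta lambda x0 xi k.
Let S k n := noise_sum G m eta lambda x0 xi k n.

Let mxi j : measurable_fun setT (xi j).
Proof. by have [] := hxi. Qed.

Let miter k : measurable_rV (iter k).
Proof. by apply: measurable_nsgd. Qed.

Let mS k n : measurable_rV (S k n).
Proof. by apply: measurable_noise_sum. Qed.

Section weighted.
Variable W : 'rV[R]_d -> R.
Hypothesis W0 : forall x, 0 <= W x.
Hypothesis mW : measurable_fun setT (W : borel_rV R d -> R).

Let mWiter k : measurable_fun setT (fun w => W (iter k w)).
Proof. by have /measurable_rVP := @miter k; exact: measurableT_comp. Qed.

Let state k (j : 'I_B) w : borel_rV R d * borel_rV R d := (iter k w, S k j w).

(** Iterate and partial noise sum depend on earlier samples only. *)
Lemma state_independent k (j : 'I_B) (A : set (borel_rV R d * borel_rV R d)) C :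
  measurable A -> measurable C ->
  P (state k j @^-1` A `&` xi (k, j) @^-1` C) = (P (state k j @^-1` A) * D C)%E.
Proof.
move=> mA mC; pose J : {fset nat * 'I_B} := earlier_samples k j.
have mpast : measurable_fun setT (state k j : sampled xi J -> _).
  have past k' i : (k' < k)%N -> measurable_fun setT (xi (k', i) : sampled xi J -> X).
    by move=> k'k; apply: measurable_sampled; rewrite earlier_samplesP /= k'k ltnW.
  apply: measurable_fun_pair; apply/measurable_rVP; first exact: measurable_nsgd.
  apply: measurable_noise_sum => // i ij; apply: measurable_sampled.
  by rewrite earlier_samplesP /= leqnn ij orbT.
apply: (sampled_independent hxi (J := J)) => //.
  by rewrite earlier_samplesP /= !ltnn andbF.
by rewrite -[X in measurable X]setTI; exact: mpast.
Qed.

(** Freezing the current iterate and the partial noise sum, the next sample adds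
    centered noise to the latter, and [moment_add_centered] applies. The weight
    depends on the iterate only, so it goes through the inner integral. *)
Lemma weighted_moment_step k (j : 'I_B) :
  (\int[P]_w (W (iter k w) * enorm (S k j.+1 w) `^ p)%:E <=
   \int[P]_w (W (iter k w) * enorm (S k j w) `^ p)%:E
   + (2 * c)%:E * \int[P]_w (W (iter k w) * enorm (m (iter k w)) `^ p)%:E)%E.
Proof.
pose h (u : (borel_rV R d * borel_rV R d) * X) : \bar R :=
  (W u.1.1 * enorm (u.1.2 + noise G m u.1.1 u.2) `^ p)%:E.
have mx : measurable_rV (fun u : (borel_rV R d * borel_rV R d) * X => u.1.1 : 'rV[R]_d).
  apply/measurable_rVP; exact: measurableT_comp measurable_fst measurable_fst.
have ms : measurable_rV (fun u : (borel_rV R d * borel_rV R d) * X => u.1.2 : 'rV[R]_d).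
  apply/measurable_rVP; exact: measurableT_comp measurable_snd measurable_fst.
have mh : measurable_fun setT h.
  apply/measurable_EFinP; apply: measurable_funM.
    by have /measurable_rVP := mx; exact: measurableT_comp.
  apply: measurable_powRc; apply: measurable_enorm; apply: measurable_rVD => //.
  apply: measurable_rVB; last exact: measurable_mean.
  exact: measurable_oracle.
have h0 u : (0 <= h u)%E by rewrite lee_fin mulr_ge0// powR_ge0.
have mstate : measurable_fun setT (state k j).
  by apply: measurable_fun_pair; apply/measurable_rVP.
have mWS n : measurable_fun setT (fun w => (W (iter k w) * enorm (S k n w) `^ p)%:E).
  apply/measurable_EFinP; apply: measurable_funM => //.
  by apply: measurable_powRc; exact: measurable_enorm.
have mWm : measurable_fun setT (fun w => (W (iter k w) * enorm (m (iter k w)) `^ p)%:E).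
  apply/measurable_EFinP; apply: measurable_funM => //.
  apply: measurable_powRc; apply: measurable_enorm; exact: measurable_mean.
have -> : (\int[P]_w (W (iter k w) * enorm (S k j.+1 w) `^ p)%:E
    = \int[P]_w h (state k j w, xi (k, j) w))%E.
  by apply: eq_integral => w _; rewrite /h /= /S noise_sumS.
rewrite (integral_freeze mstate (mxi (k, j)) (@state_independent k j) mh h0).
rewrite -ge0_integralZl//; last 2 first.
- by move=> w _; rewrite lee_fin mulr_ge0// powR_ge0.
- by rewrite lee_fin mulr_ge0.
rewrite -ge0_integralD//; last 3 first.
- by move=> w _; rewrite lee_fin mulr_ge0// powR_ge0.
- by move=> w _; rewrite -EFinM lee_fin !mulr_ge0// powR_ge0.
- exact: measurable_funeM.
apply: ge0_le_integral => //.
- by move=> w _; apply: integral_ge0 => z _; exact: h0.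
- exact: (measurableT_comp
    (@measurable_fun_fubini_tonelli_F _ _ _ _ _ D h mh h0) mstate).
- by apply: emeasurable_funD => //; exact: measurable_funeM.
move=> w _; rewrite /h /=.
under eq_integral do rewrite EFinM.
rewrite ge0_integralZl//; last 3 first.
- apply/measurable_EFinP; apply: measurable_powRc; apply: measurable_enorm.
  apply: measurable_rVD => [i|]; first exact: measurable_cst.
  apply: measurable_rVB => [|i]; last exact: measurable_cst.
  by apply: measurable_oracle => // i; exact: measurable_cst.
- by move=> z _; rewrite lee_fin powR_ge0.
- by rewrite lee_fin.
rewrite -EFinM -EFinD.
apply: (le_trans (lee_wpmul2l _ (moment_add_centered (S k j w) p12
  (noise_int _) (noise_mean _) (noise_moment _)))).
  by rewrite lee_fin.
by rewrite -EFinM lee_fin le_eqVlt; apply/orP; left; apply/eqP; ring.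
Qed.

(** A von Bahr-Esseen inequality: the [p]-th moments of independent centered
    terms add up, with the constant 2. *)
Lemma weighted_moment_sum k n : (n <= B)%N ->
  (\int[P]_w (W (iter k w) * enorm (S k n w) `^ p)%:E <=
   (2 * c * n%:R)%:E * \int[P]_w (W (iter k w) * enorm (m (iter k w)) `^ p)%:E)%E.
Proof.
elim: n => [_|n IH nB].
  rewrite mulr0 mul0e integral0_eq// => w _.
  rewrite /S /noise_sum big_pred0 ?enorm0 ?powR0 ?mulr0//.
  by apply/eqP => p0; move: p12; rewrite p0; lra.
apply: le_trans (weighted_moment_step k (Ordinal nB)) _.
have -> : (2 * c * n.+1%:R)%:E = ((2 * c * n%:R)%:E + (2 * c)%:E)%E.
  by rewrite -EFinD -[n.+1%:R]natr1 mulrDr mulr1.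
rewrite ge0_muleDl ?lee_fin ?mulr_ge0//.
by rewrite leeD2r// IH// ltnW.
Qed.

End weighted.

(** Conditionally on the iterate, with [a = enorm (m (iter k w))], the [p]-th
    moment of the error is at most [(a / 8) ^ p], so its mean is at most [a / 8].
    To conclude with unconditional expectations, Jensen's inequality is replaced
    by [weighted_young] with [u = a + e], whose weight depends on the iterate
    only; the offset [e] keeps the negative power [u `^ (1 - p)] away from zero
    and is sent to [0] at the end. *)
Lemma expected_minibatch_error k : (0 < B)%N ->
  8 `^ p * (2 * c * B%:R) <= B%:R `^ p ->
  (8%:E * \int[P]_w (enorm (B%:R^-1 *: S k B w))%:E
    <= \int[P]_w (enorm (m (iter k w)))%:E)%E.
Proof.
move=> B0 Bp; apply/lee_addgt0Pr => e e0; have /andP[p1 p2] := p12.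
pose u x : R := enorm (m x) + e; pose W x := u x `^ (1 - p).
have u0 x : 0 < u x by rewrite ltr_wpDl ?enorm_ge0.
have W0 x : 0 <= W x by exact: powR_ge0.
have b0 : 0 < B%:R :> R by rewrite ltr0n.
have bp0 : 0 < B%:R `^ p :> R by rewrite powR_gt0.
have mu : measurable_fun setT (u : borel_rV R d -> R).
  by apply: measurable_funD; [exact: measurable_enorm|exact: measurable_cst].
have mW : measurable_fun setT (W : borel_rV R d -> R) by exact: measurable_powRc.
have miterP := (measurable_rVP (iter k)).1 (@miter k).
have muk : measurable_fun setT (fun w => u (iter k w)).
  exact: (measurableT_comp mu miterP).
have mWk : measurable_fun setT (fun w => W (iter k w)).
  exact: (measurableT_comp mW miterP).
have mWS : measurable_fun setT (fun w => W (iter k w) * enorm (S k B w) `^ p).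
  by apply: measurable_funM => //; apply: measurable_powRc; exact: measurable_enorm.
have mmk : measurable_fun setT (fun w => enorm (m (iter k w))).
  by apply: measurable_enorm; exact: measurable_mean.
have mWm : measurable_fun setT (fun w => W (iter k w) * enorm (m (iter k w)) `^ p).
  by apply: measurable_funM => //; exact: measurable_powRc.
have merr : measurable_fun setT (fun w => enorm (B%:R^-1 *: S k B w)).
  by apply: measurable_enorm; apply: measurable_rVZ => //; exact: measurable_cst.
have uE : (\int[P]_w (u (iter k w))%:E = \int[P]_w (enorm (m (iter k w)))%:E + e%:E)%E.
  under eq_integral do rewrite EFinD.
  rewrite ge0_integralD//; last 3 first.
  - by move=> w _; rewrite lee_fin enorm_ge0.
  - exact/measurable_EFinP.
  - by move=> w _; rewrite lee_fin ltW.
  by rewrite integral_cst//= probability_setT mule1.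
rewrite -uE; set I := (\int[P]_w (u (iter k w))%:E)%E.
set c1 := p^-1 * (8 `^ p * (B%:R `^ p)^-1).
have c10 : 0 <= c1 by rewrite !mulr_ge0 ?invr_ge0 ?powR_ge0//; lra.
have pV1 : 0 <= 1 - p^-1 by rewrite subr_ge0 invf_le1//; lra.
have young w : 8 * enorm (B%:R^-1 *: S k B w)
    <= c1 * (W (iter k w) * enorm (S k B w) `^ p) + (1 - p^-1) * u (iter k w).
  apply: le_trans (weighted_young p1 (u0 (iter k w)) (enorm_ge0 _)) _.
  rewrite lerD2r enormZ ger0_norm ?invr_ge0 ?ler0n// powRM ?enorm_ge0 ?invr_ge0 ?ler0n//.
  rewrite -(powR_inv1 (ltW b0)) -powRrM mulN1r powRN /c1 /W -/(u _).
  by rewrite le_eqVlt; apply/orP; left; apply/eqP; ring.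
have Wm_le_u w : W (iter k w) * enorm (m (iter k w)) `^ p <= u (iter k w).
  have uE' : u (iter k w) `^ (1 - p) * u (iter k w) `^ p = u (iter k w).
    rewrite -powRD; last by rewrite (lt0r_neq0 (u0 _)) implybT.
    by rewrite subrK (powRr1 (ltW (u0 _))).
  rewrite -[leRHS]uE' ler_wpM2l ?powR_ge0//.
  apply: ge0_ler_powR; rewrite ?nnegrE ?enorm_ge0 ?(ltW (u0 _))//; first by lra.
  by rewrite lerDl ltW.
have step1 : (8%:E * \int[P]_w (enorm (B%:R^-1 *: S k B w))%:E
    <= c1%:E * \int[P]_w (W (iter k w) * enorm (S k B w) `^ p)%:E
       + (1 - p^-1)%:E * I)%E.
  rewrite -!ge0_integralZl//; last 6 first.
  - exact/measurable_EFinP.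
  - by move=> w _; rewrite lee_fin ltW.
  - exact/measurable_EFinP.
  - by move=> w _; rewrite lee_fin mulr_ge0 ?powR_ge0.
  - exact/measurable_EFinP.
  - by move=> w _; rewrite lee_fin enorm_ge0.
  rewrite -ge0_integralD//; last 4 first.
  - by move=> w _; apply: mule_ge0; rewrite lee_fin// mulr_ge0 ?powR_ge0.
  - by apply: measurable_funeM; exact/measurable_EFinP.
  - by move=> w _; apply: mule_ge0; rewrite lee_fin// ltW.
  - by apply: measurable_funeM; exact/measurable_EFinP.
  apply: ge0_le_integral => //.
  - by move=> w _; rewrite -EFinM lee_fin mulr_ge0 ?enorm_ge0.
  - by apply: measurable_funeM; exact/measurable_EFinP.
  - by apply: emeasurable_funD; apply: measurable_funeM; exact/measurable_EFinP.
  - by move=> w _; rewrite -!EFinM -EFinD lee_fin; exact: young.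
have step2 : (\int[P]_w (W (iter k w) * enorm (S k B w) `^ p)%:E
    <= (2 * c * B%:R)%:E * I)%E.
  apply: le_trans (weighted_moment_sum W0 mW k (leqnn B)) _.
  apply: lee_wpmul2l; first by rewrite lee_fin !mulr_ge0.
  apply: ge0_le_integral => //.
  - by move=> w _; rewrite lee_fin mulr_ge0 ?powR_ge0.
  - exact/measurable_EFinP.
  - exact/measurable_EFinP.
  - by move=> w _; rewrite lee_fin.
have I0 : (0 <= I)%E by apply: integral_ge0 => w _; rewrite lee_fin ltW.
apply: le_trans step1 _; apply: (@le_trans _ _ ((p^-1)%:E * I + (1 - p^-1)%:E * I)%E).
  rewrite leeD2r//; apply: le_trans (lee_wpmul2l _ step2) _; first by rewrite lee_fin.
  rewrite muleA -EFinM lee_wpmul2r// lee_fin.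
  (* The batch size makes the second factor at most 1. *)
  rewrite (_ : _ * _ = p^-1 * (8 `^ p * (2 * c * B%:R) / B%:R `^ p)); last first.
    by rewrite /c1; ring.
  by rewrite ler_piMr ?invr_ge0//; [lra|rewrite ler_pdivrMr// mul1r].
by rewrite -ge0_muleDl ?lee_fin// ?invr_ge0 -?EFinD; [rewrite addrC subrK mul1e|lra].
Qed.

End noise_moments.

(** * Convergence *)

Section convergence.
Set Implicit Arguments. Unset Strict Implicit.
Context {R : realType}.

(** Telescoping the descent inequality bounds the average of [A] over the first
    [n] indices, hence its minimum. *)
Lemma descent_min_bound (Delta : nat -> \bar R) (A : nat -> R) (t b : R) :
  0 < t -> (forall k, 0 <= Delta k)%E ->
  (forall k, Delta k.+1 + (t * A k)%:E <= Delta k + (t * b)%:E)%E ->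
  forall n F0, Delta 0%N = F0%:E -> (0 < n)%N ->
  exists k : 'I_n, A k <= F0 / (t * n%:R) + b.
Proof.
move=> t0 Delta0 step n F0 D0 n0.
have tele k : (Delta k + (t * \sum_(i < k) A i)%:E <= (F0 + t * b * k%:R)%:E)%E.
  elim: k => [|k IH]; first by rewrite big_ord0 D0 -EFinD !mulr0 !addr0.
  move: (step k) (Delta0 k) (Delta0 k.+1) IH; rewrite big_ord_recr/=.
  case: (Delta k) => [r||]//; case: (Delta k.+1) => [s||]//.
  by rewrite -!EFinD !lee_fin -[k.+1%:R]natr1; lra.
have [/existsP[k Ak]|/existsPn big] :=
  boolP [exists k : 'I_n, A k <= F0 / (t * n%:R) + b]; first by exists k.
have n0' : (0 : R) < n%:R by rewrite ltr0n.
have := tele n; have := Delta0 n; case: (Delta n) => [r||]//.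
rewrite -EFinD !lee_fin => r0.
have : \sum_(i < n) (F0 / (t * n%:R) + b) < \sum_(i < n) A i.
  rewrite ltr_sum//; last by move=> i _; rewrite ltNge big.
  by apply/hasP; exists (Ordinal n0) => //; exact: mem_index_enum.
rewrite sumr_const card_ord -(ltr_pM2l t0) -[_ *+ n]mulr_natr.
have -> : t * ((F0 / (t * n%:R) + b) * n%:R) = F0 + t * b * n%:R.
  by field; rewrite !gt_eqF.
lra.
Qed.

End convergence.

Section expectation_affine.
Set Implicit Arguments. Unset Strict Implicit.
Context {R : realType} {dO : measure_display} {Omega : measurableType dO}.
Variable P : probability Omega R.

(** With every term on the side where its sign is nonnegative, the integrals are
    additive in the extended reals. *)
Lemma expectation_affine_le (u v a e : Omega -> R) (c1 c2 c3 : R) :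
  measurable_fun setT u -> measurable_fun setT v ->
  measurable_fun setT a -> measurable_fun setT e ->
  (forall w, 0 <= u w) -> (forall w, 0 <= v w) ->
  (forall w, 0 <= a w) -> (forall w, 0 <= e w) ->
  0 <= c1 -> 0 <= c2 -> 0 <= c3 ->
  (forall w, v w + c1 * a w <= u w + c2 * e w + c3) ->
  (\int[P]_w (v w)%:E + c1%:E * \int[P]_w (a w)%:E
   <= \int[P]_w (u w)%:E + c2%:E * \int[P]_w (e w)%:E + c3%:E)%E.
Proof.
move=> mu mv ma me u0 v0 a0 e0 c10 c20 c30 le_uv.
have mE (g : Omega -> R) : measurable_fun setT g ->
    measurable_fun setT (fun w : Omega => (g w)%:E).
  by move=> mg; exact/measurable_EFinP.
have mZ (g : Omega -> R) c : measurable_fun setT g ->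
    measurable_fun setT (fun w : Omega => (c%:E * (g w)%:E)%E).
  by move=> mg; apply: measurable_funeM; exact: mE.
have ZE (g : Omega -> R) c : measurable_fun setT g -> (forall w, 0 <= g w) -> 0 <= c ->
    (c%:E * \int[P]_w (g w)%:E = \int[P]_w (c%:E * (g w)%:E))%E.
  move=> mg g0 c_ge0; rewrite ge0_integralZl//; first exact: mE.
  by move=> w _; rewrite lee_fin.
have Z0 (g : Omega -> R) c (w : Omega) :
    0 <= c -> (forall w, 0 <= g w) -> (0 <= c%:E * (g w)%:E)%E.
  by move=> c_ge0 g0; rewrite -EFinM lee_fin mulr_ge0.
have cE : c3%:E = (\int[P]_w c3%:E)%E.
  by rewrite integral_cst//= probability_setT mule1.
rewrite (ZE a)// (ZE e)// cE -!ge0_integralD//;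
  try by move=> w _; rewrite ?adde_ge0 ?Z0 ?lee_fin.
all: try by [exact: mE|exact: mZ|apply: emeasurable_funD; [exact: mE|exact: mZ]].
apply: ge0_le_integral => //.
- by move=> w _; rewrite adde_ge0 ?Z0 ?lee_fin.
- by apply: emeasurable_funD; [exact: mE|exact: mZ].
- apply: emeasurable_funD; last exact: measurable_cst.
  by apply: emeasurable_funD; [exact: mE|exact: mZ].
- by move=> w _; rewrite -!EFinM -!EFinD lee_fin.
Qed.

End expectation_affine.

(* For L0 = L1 = 0 the upper bound lambda / (L0 + L1 * lambda) is +oo, hence the
   guard in [heta_le]. *)
Theorem proposition4p4 (R : realType) (d : nat)
  (dX : measure_display) (X : measurableType dX) (D : probability X R)
  (F : 'rV[R]_d -> X -> R) (f : 'rV[R]_d -> R)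
  (G : 'rV[R]_d -> X -> 'rV[R]_d)
  (fstar L0 L1 p rho eta lambda : R) (x0 : 'rV[R]_d) (B N : nat)
  (dO : measure_display) (Omega : measurableType dO) (P : probability Omega R)
  (xi : nat * 'I_B -> Omega -> X)
  (hf : is_expected_loss D F f)
  (hdiff : forall x, differentiable f x)
  (hmin : is_minimum f fstar)
  (hL0 : 0 <= L0) (hL1 : 0 <= L1)
  (hsmooth : L0L1_smooth L0 L1 f)
  (horacle : stochastic_gradient_oracle F G)
  (hunbiased : unbiased D f G)
  (hp : 1 < p < 2)
  (hrho : 1 <= rho)
  (hgrowth : strong_growth D p rho f G)
  (hlambda : 0 < lambda)
  (heta : 0 < eta)
  (heta_le : 0 < L0 + L1 * lambda -> eta <= lambda / (L0 + L1 * lambda))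
  (hB : (1 <= B)%N)
  (hB_ge : 2 `^ ((3 * p + 1) / (p - 1)) * (rho - 1) `^ (1 / (p - 1)) <= B%:R)
  (hN : (1 <= N)%N)
  (hxi : iid P D xi) :
  (\big[mine/+oo]_(k < N)
     'E_P[fun w => enorm (grad f (nsgd G eta lambda x0 xi k w))]
   <= (4 * (f x0 - fstar) / (eta * N%:R) + 6 * lambda)%:E)%E.
Proof.
have /andP[p1 p2] := hp; have p12 : 1 <= p <= 2 by rewrite !ltW.
have c0 : 0 <= rho - 1 by rewrite subr_ge0.
have etaL : eta * (L0 + L1 * lambda) <= lambda.
  have : 0 <= L0 + L1 * lambda by rewrite addr_ge0// mulr_ge0// ltW.
  rewrite le_eqVlt => /predU1P[<-|L_gt0]; first by rewrite mulr0 ltW.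
  by rewrite -ler_pdivlMr//; exact: heta_le.
have [mG _] := horacle; have [[_ _] fge] := hmin.
have mgrad : measurable_rV (grad f : borel_rV R d -> 'rV[R]_d).
  move=> i; apply: continuous_borel_rV_measurable.
  exact: L0L1_grad_continuous hsmooth.
have int_noise x i :
    D.-integrable setT (EFin \o (fun z => noise G (grad f) x z ord0 i)).
  rewrite (_ : EFin \o _ = (EFin \o (fun z => G x z ord0 i))
      \- cst (grad f x ord0 i)%:E)%E.
    apply: integrableB => //; first by case: (hunbiased x i).
    exact: finite_measure_integrable_cst.
  by apply/funext => z; rewrite /= /noise !mxE EFinB.
have mean_noise x i : ('E_D[fun z => noise G (grad f) x z ord0 i] = 0)%E.
  have [intG meanG] := hunbiased x i; rewrite unlock in meanG *.
  under eq_integral do rewrite /noise !mxE EFinB.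
  rewrite integralB//; last exact: finite_measure_integrable_cst.
  by rewrite meanG integral_cst//= probability_setT mule1 /grad mxE subee.
have moment_noise x : (\int[D]_z (enorm (noise G (grad f) x z) `^ p)%:E
    <= ((rho - 1) * enorm (grad f x) `^ p)%:E)%E.
  by have := hgrowth x; rewrite unlock.
have batch : 8 `^ p * (2 * (rho - 1) * B%:R) <= B%:R `^ p.
  by apply: batch_size_bound; rewrite ?ltr0n.
pose x k w := nsgd G eta lambda x0 xi k w.
pose a k w := enorm (grad f (x k w)).
pose err k w :=
  enorm (B%:R^-1 *: noise_sum G (grad f) eta lambda x0 xi k B w).
have err_le k : (8%:E * \int[P]_w (err k w)%:E <= \int[P]_w (a k w)%:E)%E.
  exact: (expected_minibatch_error eta x0 hlambda mG mgrad p12 c0 int_noise mean_noise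
    moment_noise hxi k hB batch).
have mxi j : measurable_fun setT (xi j) by have [] := hxi.
have mx k : measurable_rV (x k) by exact: measurable_nsgd.
have ma k : measurable_fun setT (a k).
  by apply: measurable_enorm; exact: measurable_mean.
have merr k : measurable_fun setT (err k).
  apply: measurable_enorm; apply: measurable_rVZ; first exact: measurable_cst.
  exact: measurable_noise_sum.
have mf k : measurable_fun setT (fun w => f (x k w)).
  apply: (measurableT_comp (@continuous_borel_rV_measurable _ _ f _)).
    by move=> y; exact: differentiable_continuous.
  exact/measurable_rVP.
pose Delta k := (\int[P]_w (f (x k w) - fstar)%:E)%E.
have a_fin k : (\int[P]_w (a k w)%:E)%E \is a fin_num.
  have [M aM] := nsgd_grad_bounded G x0 xi k hsmooth hL0 hL1 heta hlambda etaL.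
  rewrite ge0_fin_numE; last by apply: integral_ge0 => w _; rewrite lee_fin enorm_ge0.
  apply: (@le_lt_trans _ _ (\int[P]_w M%:E)%E); last first.
    by rewrite integral_cst//= probability_setT mule1 ltry.
  apply: ge0_le_integral => //.
  - by move=> w _; rewrite lee_fin enorm_ge0.
  - exact/measurable_EFinP.
  - by move=> w _; rewrite lee_fin; exact: aM.
pose A k := fine (\int[P]_w (a k w)%:E).
have AE k : (\int[P]_w (a k w)%:E = (A k)%:E)%E by rewrite fineK.
have Delta0 k : (0 <= Delta k)%E.
  by apply: integral_ge0 => w _; rewrite lee_fin subr_ge0.
have descent k w : f (x k.+1 w) - fstar + eta / 2 * a k w
    <= f (x k w) - fstar + 2 * eta * err k w + 3 / 2 * eta * lambda.
  have := nsgd_step_descent (x k w) (minibatch G (x k w) (fun i => xi (k, i) w))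
    hdiff hsmooth hL0 hL1 heta hlambda etaL.
  by rewrite minibatch_error// -/(a k w) -/(err k w) /nsgd_step; lra.
have step k : (Delta k.+1 + (eta / 4 * A k)%:E
    <= Delta k + (eta / 4 * (6 * lambda))%:E)%E.
  (* Half of the gain [eta / 2 * a] pays for the error term [2 * eta * err],
     whose mean is at most [eta / 4] times that of [a]. *)
  have : (Delta k.+1 + (eta / 2)%:E * \int[P]_w (a k w)%:E
      <= Delta k + (2 * eta)%:E * \int[P]_w (err k w)%:E + (3 / 2 * eta * lambda)%:E)%E.
    apply: expectation_affine_le => //; try by rewrite !mulr_ge0// ltW.
    - by apply: measurable_funB => //; exact: measurable_cst.
    - by apply: measurable_funB => //; exact: measurable_cst.
    - by move=> w; rewrite subr_ge0.
    - by move=> w; rewrite subr_ge0.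
    - by move=> w; exact: enorm_ge0.
    - by move=> w; exact: enorm_ge0.
  have eta4 : (0 <= (eta / 4)%:E)%E by rewrite lee_fin divr_ge0// ltW.
  have := lee_wpmul2l eta4 (err_le k); rewrite AE muleA -!EFinM.
  rewrite (_ : eta / 4 * 8 = 2 * eta); last by field.
  move: (Delta0 k) (Delta0 k.+1).
  case: (Delta k) => [r||]// _; case: (Delta k.+1) => [s||]// _.
  - case: (_ * _)%E => [q||]// hq; rewrite -!EFinD !lee_fin in hq *; lra.
  - by case: (_ * _)%E => [q||].
  - by move=> _ _; rewrite leey.
have Delta_start : Delta 0%N = (f x0 - fstar)%:E.
  have -> : (Delta 0%N = \int[P]_w (f x0 - fstar)%:E)%E by [].
  by rewrite integral_cst//= probability_setT mule1.
have [k Ak] :=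
  descent_min_bound (divr_gt0 heta (ltr0n R 4)) Delta0 step Delta_start hN.
apply: (bigmin_inf k) => //.
rewrite unlock AE lee_fin; apply: (le_trans Ak).
by rewrite lerD2r le_eqVlt; apply/orP; left; apply/eqP; field; rewrite !gt_eqF ?ltr0n.
Qed.
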